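(* Let $A,B\in\mathcal{L}(\mathcal{H})$ be indefinite selfadjoint operators with $N(A)\cap N(B)=\{0\}$, and assume that $I_\geq(A,B)=[\lambda_-,\lambda_+]$ with $\lambda_-<\lambda_+$. Let $\mathcal{R}=R\big((A+\rho B)^{1/2}\big)$ with $\rho=\frac{\lambda_-+\lambda_+}{2}$, and let $\beta\in\mathbb{R}$. Then $\mathcal{Z}(\beta,a,b)\neq\varnothing$ for every $a\in\mathcal{R}$ and every $b\in R(B)$ if and only if the following conditions hold: (i) $I_\geq(A,B)=[\lambda_-,\lambda_+]$ with $\lambda_-<\lambda_+$; (ii) $N(A+\lambda_-B)\neq\{0\}$ and $N(A+\lambda_+B)\neq\{0\}$; (iii) $R(A+\lambda B)=\mathcal{H}$ for some $\lambda\in(\lambda_-,\lambda_+)$.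
   Context: $\mathcal{H}$ is a complex separable Hilbert space with inner product $\langle\cdot,\cdot\rangle$; $\mathcal{L}(\mathcal{H})$ is the algebra of bounded linear operators on $\mathcal{H}$; $N(T)$ and $R(T)$ denote the kernel and the range of $T$. A selfadjoint operator is indefinite if it is neither positive semidefinite nor negative semidefinite. For $a,b\in\mathcal{H}$ and $\beta\in\mathbb{R}$ set $f(x)=\langle Ax,x\rangle+2\operatorname{Re}\langle a,x\rangle$ and $g(x)=\langle Bx,x\rangle+2\operatorname{Re}\langle b,x\rangle$. $\mathcal{Z}(\beta,a,b)$ is the set of solutions (global minimizers) of: minimize $f(x)$ subject to $g(x)=\beta$. $I_\geq(A,B)=\{\lambda\in\mathbb{R}: A+\lambda B \text{ is positive semidefinite}\}$. When nonempty it is the closed bounded interval $[\lambda_-,\lambda_+]$, where $$\lambda_-=-\inf_{\langle Bx,x\rangle>0}\frac{\langle Ax,x\rangle}{\langle Bx,x\rangle},\qquad \lambda_+=-\sup_{\langle Bx,x\rangle<0}\frac{\langle Ax,x\rangle}{\langle Bx,x\rangle}.$$ *)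

(* Defs.v *)
From HB Require Import structures.
From mathcomp Require Import all_boot all_order all_algebra sesquilinear complex.
From mathcomp Require Import boolp classical_sets cardinality set_interval reals.
From mathcomp Require Import topology normedtype.

Set Implicit Arguments.
Unset Strict Implicit.
Unset Printing Implicit Defensive.

Import Order.TTheory GRing.Theory Num.Theory.
Import numFieldNormedType.Exports.

Local Open Scope classical_set_scope.
Local Open Scope ring_scope.
Local Open Scope complex_scope.

Section Definitions.
Context (R : realType) (H : completeNormedModType R[i]).
(* In [{dot H for Num.conj}] the form is linear in its first argument. *)
Context (ip : {dot H for Num.conj}).
Implicit Types (A B S T : H -> H) (a b x : H) (lambda beta : R).

(* [H] is complete for its norm, so under this condition it is Hilbert. *)
Definition norm_of_inner_product := forall x, `|x| ^+ 2 = ip x x.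

Definition separable := exists2 D : set H, countable D & dense D.

Definition bounded_operator T := linear T /\ bounded_near T (nbhs (0 : H)).

Definition kernel T : set H := [set x | T x = 0].

Definition selfadjoint T := forall x y, ip (T x) y = ip x (T y).

(* An inequality in [R[i]] entails that its two sides differ by a real number,
   so these conditions force [ip (T x) x] to be real. *)
Definition positive_semidefinite T := forall x, 0 <= ip (T x) x.
Definition negative_semidefinite T := forall x, ip (T x) x <= 0.

Definition indefinite T :=
  ~ positive_semidefinite T /\ ~ negative_semidefinite T.

(* Every bounded positive semidefinite [T] has exactly one such [S]; the zero
   operator is the default value for the other [T]. *)
Definition sqrt_operator T : H -> H :=
  xget (fun=> 0) [set S | [/\ bounded_operator S, positive_semidefinite S
                            & forall x, S (S x) = T x]].

Definition pencil A B lambda : H -> H := fun x => A x + lambda%:C *: B x.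

Definition Igeq A B : set R :=
  [set lambda | positive_semidefinite (pencil A B lambda)].

(* For [T] selfadjoint, [ip (T x) x] is real and [Re] only changes its type. *)
Definition qform T x : R := complex.Re (ip (T x) x).

(* [inf] and [sup] are total, with value 0 on sets that are empty or unbounded
   on the relevant side; if [B] is indefinite and [Igeq A B] is nonempty,
   neither case occurs. *)
Definition lambda_minus A B : R :=
  - inf [set qform A x / qform B x | x in [set x | 0 < qform B x]].
Definition lambda_plus A B : R :=
  - sup [set qform A x / qform B x | x in [set x | qform B x < 0]].

Definition quadratic_fun T a x : R := qform T x + 2 * complex.Re (ip a x).

Definition minimizers A B beta a b : set H :=
  [set x | quadratic_fun B b x = beta /\
    forall y, quadratic_fun B b y = beta ->
      quadratic_fun A a x <= quadratic_fun A a y].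

End Definitions.

(* Main.v *)
Require Import Defs.
From HB Require Import structures.
From mathcomp Require Import all_boot all_order all_algebra sesquilinear complex.
From mathcomp Require Import boolp classical_sets cardinality set_interval reals.
From mathcomp Require Import topology normedtype sequences realfun.
From mathcomp Require Import ring lra.

Set Implicit Arguments.
Unset Strict Implicit.
Unset Printing Implicit Defensive.

Import Order.TTheory GRing.Theory Num.Theory.
Import numFieldNormedType.Exports.

Local Open Scope classical_set_scope.
Local Open Scope ring_scope.
Local Open Scope complex_scope.

(** Write q_T(x) for <T x, x>, and let C = A + rho B with rho the midpoint of
    the interval. All estimates take place in the real Hilbert space underlying
    H, with inner product [rdot] = Re <., .> and norm [rnorm].

    Conditions (ii) and (iii) imply solvability. Minimising f on { g = beta } is
    relaxed to minimising, over the whole space,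
      F(x) = max over lambda in [lm, lp] of f(x) + lambda (g(x) - beta).
    The expression is affine in lambda, so F is the larger of its two values at
    the endpoints, where A + lambda B is positive semidefinite: F is convex and
    continuous. A surjective positive operator is bounded below
    ([surjective_coercive]), so one inner lambda makes F coercive, and F has a
    minimiser x0 ([convex_coercive_min]). If g(x0) >= beta, move x0 along a
    nonzero v in N(A + lp B): q_B(v) < 0, so g descends to beta, while the
    Lagrangian at lp is affine in that direction and does not increase when the
    sign of v is right ([lagrangian_slide]). The point reached is feasible, and
    its value f is at most F(x0), hence at most f at every feasible point. If
    g(x0) < beta, use N(A + lm B).

    Solvability implies (iii). Let S be the square root of C. It is injective,
    because N(A) and N(B) meet trivially, so its range is dense
    ([dense_range]). For b = 0 and a = - S a', the problem is to find the point
    of S { q_B = beta } closest to a'. Since |q_B| <= |S .|^2 / delta with delta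
    the half-length of the interval, q_B extends continuously along S to all of
    H; hence each a in H has a translate a + S w which is a limit of points S z
    with q_B(z) = beta exactly ([level_set_approx]). The closest point to such a
    limit is the limit itself, so a + S w, and therefore a, lies in R(S). Thus S
    is onto, and so is C = S S.

    Solvability implies (ii). With b = B w and a = A w, now allowed as R(S) = H,
    the substitution x + w turns the problem into minimising q_A on a level set
    of q_B of arbitrary level ([minimizers_shift]). By homogeneity a minimiser at
    level 1 realises the infimum defining lm, hence is a null vector of
    A + lm B; level -1 does the same for lp. *)

(** * The underlying real inner product space *)

Section RealInnerProduct.
Context (R : realType) (H : completeNormedModType R[i]).
Context (ip : {dot H for Num.conj}).
Implicit Types (x y z : H) (r t : R).

Definition rdot x y : R := complex.Re (ip x y).
Definition rnorm x : R := complex.Re `|x|.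

Lemma rdotC x y : rdot x y = rdot y x.
Proof.
rewrite /rdot (@hermC _ _ _ _ ip) expr0 mul1r; apply: (@complexI R).
by rewrite !complexRe; exact: Re_conj.
Qed.

Lemma rdotDl x y z : rdot (x + y) z = rdot x z + rdot y z.
Proof. by rewrite /rdot linearDl raddfD. Qed.

Lemma rdotZl r x y : rdot (r%:C *: x) y = r * rdot x y.
Proof. by rewrite /rdot linearZl_LR /=; case: (ip x y) => u v /=; rewrite mul0r subr0. Qed.

Lemma rdotDr x y z : rdot z (x + y) = rdot z x + rdot z y.
Proof. by rewrite ![rdot z _]rdotC rdotDl. Qed.

Lemma rdotZr r x y : rdot x (r%:C *: y) = r * rdot x y.
Proof. by rewrite rdotC rdotZl rdotC. Qed.

Lemma scaleN1 x : - x = (-1)%:C *: x.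
Proof. by rewrite rmorphN1 scaleN1r. Qed.

Lemma rdotNl x y : rdot (- x) y = - rdot x y.
Proof. by rewrite scaleN1 rdotZl mulN1r. Qed.

Lemma rdotNr x y : rdot x (- y) = - rdot x y.
Proof. by rewrite scaleN1 rdotZr mulN1r. Qed.

Definition rdotE := (rdotDl, rdotDr, rdotNl, rdotNr, rdotZl, rdotZr).

Lemma rnorm_ge0 x : 0 <= rnorm x.
Proof. by have := normr_ge0 x; rewrite lecE => /andP[]. Qed.

Lemma normE x : `|x| = (rnorm x)%:C.
Proof. by rewrite /rnorm RRe_real // ger0_real. Qed.

Lemma rnormD x y : rnorm (x + y) <= rnorm x + rnorm y.
Proof. by have := ler_normD x y; rewrite !normE -rmorphD lecR. Qed.

Lemma rnormN x : rnorm (- x) = rnorm x.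
Proof. by rewrite /rnorm normrN. Qed.

Lemma rnorm0 : rnorm 0 = 0.
Proof. by rewrite /rnorm normr0. Qed.

Lemma rnormZ r x : rnorm (r%:C *: x) = `|r| * rnorm x.
Proof.
apply: (@complexI R); rewrite -normE normrZ normE rmorphM; congr (_ * _).
by rewrite normc_def /= expr0n addr0 sqrtr_sqr.
Qed.

Lemma rnorm_eq0 x : rnorm x = 0 -> x = 0.
Proof. by move=> x0; apply/eqP; rewrite -normr_eq0 normE x0. Qed.

Context (normH : norm_of_inner_product ip).

Lemma rdotxx x : rdot x x = rnorm x ^+ 2.
Proof. by rewrite /rdot -normH normE -rmorphXn. Qed.

Lemma rdotxx_eq0 x : rdot x x = 0 -> x = 0.
Proof. by rewrite rdotxx => /eqP; rewrite sqrf_eq0 => /eqP/rnorm_eq0. Qed.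

Lemma rdot_le x y : `|rdot x y| <= rnorm x * rnorm y.
Proof.
have [/rnorm_eq0->|x0] := eqVneq (rnorm x) 0.
  by rewrite rnorm0 mul0r -(scale0r (0 : H)) (rdotZl 0 0) mul0r normr0.
have [/rnorm_eq0->|y0] := eqVneq (rnorm y) 0.
  by rewrite rnorm0 mulr0 -(scale0r (0 : H)) (rdotZr 0) mul0r normr0.
have xp : 0 < rnorm x by rewrite lt_def x0 rnorm_ge0.
have yp : 0 < rnorm y by rewrite lt_def y0 rnorm_ge0.
have xyp : 0 < rnorm x * rnorm y by rewrite mulr_gt0.
(* s = 1 and s = -1 give the two sides of the absolute value *)
have h (s : R) : s ^+ 2 = 1 -> s * rdot x y <= rnorm x * rnorm y.
  move=> s1.
  have := sqr_ge0 (rnorm ((rnorm y)%:C *: x + (- s * rnorm x)%:C *: y)).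
  rewrite -rdotxx !rdotE (rdotC y x) !rdotxx.
  set X := rnorm x; set Y := rnorm y; set d := rdot x y.
  have -> : Y * (Y * X ^+ 2 + - s * X * d) + - s * X * (Y * d + - s * X * Y ^+ 2)
    = (1 + s ^+ 2) * (X * Y) ^+ 2 - 2 * (X * Y) * (s * d) by ring.
  rewrite s1 (_ : _ - _ = 2 * ((X * Y) * (X * Y - s * d))); last by ring.
  by rewrite pmulr_rge0 // pmulr_rge0 // subr_ge0.
rewrite ler_norml; apply/andP; split.
  by have := h (-1); rewrite sqrrN expr1n => /(_ erefl); lra.
by have := h 1; rewrite expr1n mul1r => /(_ erefl).
Qed.

(** Norm convergence, with the distance taken in [R] so that limits of real
    expressions never pass through [R[i]]. *)
Definition ncvg (u : nat -> H) (p : H) := (fun n => rnorm (u n - p)) @ \oo --> 0.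

Lemma ncvgP u p : ncvg u p <->
  forall e : R, 0 < e -> \forall n \near \oo, rnorm (u n - p) < e.
Proof.
split=> [/cvgr0Pnorm_lt h e e0|h].
  by apply: filterS (h e e0) => n; apply: le_lt_trans; exact: ler_norm.
apply/cvgr0Pnorm_lt => e e0; near=> n.
by rewrite ger0_norm ?rnorm_ge0//; near: n; exact: h.
Unshelve. all: by end_near. Qed.

Lemma rnorm_complete (u : nat -> H) :
  (forall e : R, 0 < e -> exists N, forall m n, (N <= m)%N -> (N <= n)%N ->
     rnorm (u m - u n) < e) -> exists p, ncvg u p.
Proof.
move=> h.
have /cauchy_cvg : cauchy (u @ \oo).
  apply/cauchy_ballP => e e0.
  have [r r0 re] : exists2 r : R, 0 < r & e = r%:C.
    by move: e0; case: e => a b; rewrite ltcE /= => /andP[/eqP-> a0]; exists a.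
  have [N hN] := h _ r0.
  exists ([set u n | n in [set n | (N <= n)%N]], [set u n | n in [set n | (N <= n)%N]]).
    by split; exists N => // n /= Nn; exists n.
  move=> [_ _] [[m /= Nm <-] [n /= Nn <-]] /=.
  by rewrite -ball_normE /= normE re ltcR; exact: hN.
move=> /cvg_ex[p up]; exists p; apply/ncvgP => e e0.
have e0' : 0 < e%:C :> R[i] by rewrite ltcR.
move/cvgrPdist_lt : up => /(_ _ e0') up.
by near=> n; rewrite -ltcR -normE distrC; near: n.
Unshelve. all: by end_near. Qed.

Lemma ncvg_cst p : ncvg (fun=> p) p.
Proof. by apply/ncvgP => e e0; near=> n; rewrite subrr rnorm0.
Unshelve. all: by end_near. Qed.

Lemma ncvg_le u p (c : nat -> R) :
  (forall n, rnorm (u n - p) <= c n) -> c @ \oo --> 0 -> ncvg u p.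
Proof.
move=> uc c0; apply: squeeze_cvgr (cvg_cst 0) c0.
by near=> n; rewrite rnorm_ge0 uc.
Unshelve. all: by end_near. Qed.

Lemma ncvgD u v p q : ncvg u p -> ncvg v q -> ncvg (fun n => u n + v n) (p + q).
Proof.
move=> up vq.
apply: (@ncvg_le _ _ (fun n => rnorm (u n - p) + rnorm (v n - q))).
  by move=> n; apply: le_trans (rnormD _ _); rewrite opprD addrACA.
by rewrite -[0]addr0; apply: cvgD.
Qed.

Lemma ncvg_rdot u v p q : ncvg u p -> ncvg v q ->
  (fun n => rdot (u n) (v n)) @ \oo --> rdot p q.
Proof.
move=> up vq; apply/subr_cvg0.
(* bound from (p + e) . (q + e') - p . q = e . e' + e . q + p . e' *)
pose c n := rnorm (u n - p) * rnorm (v n - q) + rnorm (u n - p) * rnorm q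
           + rnorm p * rnorm (v n - q).
have c0 : c @ \oo --> 0.
  rewrite (_ : 0 = 0 * 0 + 0 * rnorm q + rnorm p * 0); last by rewrite !mul0r mulr0 !addr0.
  by apply: cvgD; [apply: cvgD|]; apply: cvgM => //; exact: cvg_cst.
apply/norm_cvg0P; apply: squeeze_cvgr (cvg_cst 0) c0; near=> n.
rewrite normr_ge0 /=.
have -> : rdot (u n) (v n) - rdot p q =
   rdot (u n - p) (v n - q) + rdot (u n - p) q + rdot p (v n - q).
  by rewrite !rdotE; ring.
rewrite /c (le_trans (ler_normD _ _))// lerD ?rdot_le//.
by rewrite (le_trans (ler_normD _ _))// lerD ?rdot_le.
Unshelve. all: by end_near. Qed.

Lemma ncvgZ (s : nat -> R) (l : R) u p : s @ \oo --> l -> ncvg u p ->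
  ncvg (fun n => (s n)%:C *: u n) (l%:C *: p).
Proof.
move=> sl up.
apply: (@ncvg_le _ _ (fun n => `|s n| * rnorm (u n - p) + `|s n - l| * rnorm p)).
  move=> n; rewrite -!rnormZ; apply: le_trans (rnormD _ _).
  by rewrite scalerBr rmorphB scalerBl addrA subrK.
rewrite (_ : 0 = `|l| * 0 + 0 * rnorm p); last by rewrite mulr0 mul0r addr0.
apply: cvgD; apply: cvgM => //; [exact: cvg_norm|exact/norm_cvg0P/subr_cvg0|exact: cvg_cst].
Qed.

Lemma ncvg_unique u p q : ncvg u p -> ncvg u q -> p = q.
Proof.
move=> up uq; apply/subr0_eq/rnorm_eq0.
have /(cvg_lim (@norm_hausdorff _ _)) <- : ncvg (fun=> p) q.
  apply: (@ncvg_le _ _ (fun n => rnorm (u n - p) + rnorm (u n - q))).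
    move=> n; rewrite -(rnormN (u n - p)); apply: le_trans (rnormD _ _).
    by rewrite opprB addrA subrK.
  by rewrite -[0]addr0; apply: cvgD.
by rewrite lim_cst.
Qed.

Lemma ncvg_rnorm u p : ncvg u p -> (fun n => rnorm (u n)) @ \oo --> rnorm p.
Proof.
move=> up; rewrite -[rnorm p]ger0_norm ?rnorm_ge0// -sqrtr_sqr.
rewrite (_ : (fun n => _) = fun n => Num.sqrt (rdot (u n) (u n))); last first.
  by apply/funext => n; rewrite rdotxx sqrtr_sqr ger0_norm ?rnorm_ge0.
rewrite -rdotxx; apply: continuous_cvg; [exact: sqrt_continuous|exact: ncvg_rdot].
Qed.

End RealInnerProduct.

(** * Minimal norms in nested convex sets, and convex minimisation *)

Section Minimisation.
Context (R : realType) (H : completeNormedModType R[i]).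
Context (ip : {dot H for Num.conj}).
Context (normH : norm_of_inner_product ip).
Implicit Types (x y z : H) (r t : R).

Definition midpoint x y : H := (2^-1)%:C *: (x + y).

Lemma parallelogram x y :
  rnorm (x - y) ^+ 2 = 2 * rnorm x ^+ 2 + 2 * rnorm y ^+ 2
                       - 4 * rnorm (midpoint x y) ^+ 2.
Proof.
rewrite -!(rdotxx normH) /midpoint !rdotE (rdotC ip y x).
by field.
Qed.

(** Substitute for weak compactness: almost-shortest elements of the [E n] form
    a Cauchy sequence by the parallelogram law, since the minimal norms increase
    to a limit and midpoints stay in the sets. The limit [p] is at most as long
    as any bound valid in all the sets. *)
Lemma min_norm_nested (E : nat -> set H) (r0 : R) :
  (forall n x, E n.+1 x -> E n x) ->
  (forall n x y, E n x -> E n y -> E n (midpoint x y)) ->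
  (forall n, exists2 x, E n x & rnorm x <= r0) ->
  exists u p, [/\ forall n, E n (u n), ncvg u p &
    forall r, (forall n, exists2 x, E n x & rnorm x <= r) -> rnorm p <= r].
Proof.
move=> Edec Emid Eball.
pose S n := [set rnorm x ^+ 2 | x in E n]; pose d n := inf (S n).
have lbS n : has_lbound (S n) by exists 0 => _ [x _ <-]; exact: sqr_ge0.
have infS n : has_inf (S n).
  by split=> //; have [x Ex _] := Eball n; exists (rnorm x ^+ 2), x.
have dle n x : E n x -> d n <= rnorm x ^+ 2 by move=> Ex; apply: ge_inf => //; exists x.
have dball r n : (exists2 x, E n x & rnorm x <= r) -> d n <= r ^+ 2.
  move=> [x Ex xr]; apply: le_trans (dle _ _ Ex) _.
  by rewrite ler_sqr ?nnegrE ?rnorm_ge0 ?(le_trans _ xr) ?rnorm_ge0.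
have Ele m n x : (n <= m)%N -> E m x -> E n x.
  elim: m => [|m IH]; first by rewrite leqn0 => /eqP->.
  by rewrite leq_eqVlt => /predU1P[-> //|nm /Edec]; apply: IH.
have dnd : nondecreasing_seq d.
  move=> n m nm; apply: lb_le_inf; first by case: (infS m).
  by move=> _ [x Ex <-]; apply: dle; apply: Ele Ex.
have dcv : cvgn d.
  apply: nondecreasing_is_cvgn => //; exists (r0 ^+ 2) => _ [n _ <-].
  exact/dball/Eball.
set D : R := limn d in dcv *.
have dD n : d n <= D by exact: nondecreasing_cvgn_le.
have /choice[u uP] n : exists x, E n x /\ rnorm x ^+ 2 < d n + n.+1%:R^-1.
  have [|_ [x Ex <-] xl] := @inf_adherent _ (S n) n.+1%:R^-1 _ (infS n).
    by rewrite invr_gt0.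
  by exists x.
(* c N bounds the squared distance between any two terms after rank N *)
pose c n := 4 * (D - d n) + 4 * n.+1%:R^-1.
have c0 : c @ \oo --> 0.
  rewrite (_ : 0 = 4 * (D - D) + 4 * 0); last by rewrite subrr !mulr0 addr0.
  apply: cvgD; apply: cvgM; try exact: cvg_cst; last exact: cvg_harmonic.
  by apply: cvgB => //; exact: cvg_cst.
have uc N m n : (N <= m)%N -> (N <= n)%N -> rnorm (u m - u n) ^+ 2 <= c N.
  move=> Nm Nn; rewrite parallelogram /c.
  have [Em um] := uP m; have [En un] := uP n.
  have : m.+1%:R^-1 <= N.+1%:R^-1 :> R by rewrite lef_pV2 ?posrE // ler_nat.
  have : n.+1%:R^-1 <= N.+1%:R^-1 :> R by rewrite lef_pV2 ?posrE // ler_nat.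
  move: (dD m) (dD n) (dle _ _ (Emid N _ _ (Ele _ _ _ Nm Em) (Ele _ _ _ Nn En))) um un.
  move: (_^-1) (_^-1) (_^-1) (_ ^+ 2) (_ ^+ 2) (_ ^+ 2) (d m) (d n) (d N) => *; lra.
have [p up] : exists p, ncvg u p.
  apply: rnorm_complete => e e0.
  have e2 : 0 < e ^+ 2 by rewrite exprn_gt0.
  have [N _ /(_ N (leqnn N)) cN] := (cvgr0Pnorm_lt c).1 c0 _ e2.
  exists N => m n Nm Nn.
  have := uc N m n Nm Nn => h.
  rewrite -ltr_sqr ?nnegrE ?rnorm_ge0 ?ltW//.
  by apply: le_lt_trans h _; apply: le_lt_trans (ler_norm _) cN.
exists u, p; split=> [n||r hr]; [by case: (uP n)|by []|].
have r0' : 0 <= r by have [x _ ] := hr 0%N; apply: le_trans; exact: rnorm_ge0.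
rewrite -ler_sqr ?nnegrE ?rnorm_ge0//.
have h1 := ncvg_rdot normH up up.
have h2 : (fun n => r ^+ 2 + n.+1%:R^-1) @ \oo --> r ^+ 2.
  rewrite -[X in _ --> X]addr0; apply: cvgD; [exact: cvg_cst|exact: cvg_harmonic].
rewrite -(rdotxx normH) -(cvg_lim _ h1)// -(cvg_lim _ h2)//.
apply: ler_lim; [exact: cvgP h1|exact: cvgP h2|].
near=> n; rewrite (rdotxx normH); have [_ /ltW] := uP n.
by move/le_trans; apply; rewrite lerD2r; exact: dball.
Unshelve. all: by end_near. Qed.

(** Apply [min_norm_nested] to the sublevel sets { F <= inf F + 1/(n+1) }: they
    are stable under midpoints, and coercivity puts them in a common ball. *)
Lemma convex_coercive_min (F : H -> R) (k b d : R) :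
  (forall x y r, F x <= r -> F y <= r -> F (midpoint x y) <= r) ->
  (forall u p, ncvg u p -> (fun n => F (u n)) @ \oo --> F p) ->
  0 < k -> (forall x, k * rnorm x ^+ 2 - b * rnorm x - d <= F x) ->
  exists x0, forall y, F x0 <= F y.
Proof.
move=> Fmid Fcont k0 Fco.
have FinfS : has_inf (range F).
  split; first by exists (F 0), 0.
  (* lower bound by completing the square in k s^2 - b s *)
  exists (- (b ^+ 2 / (4 * k)) - d) => _ [x _ <-]; apply: le_trans (Fco x).
  have : 0 <= k * (rnorm x - b / (2 * k)) ^+ 2 by rewrite mulr_ge0 ?sqr_ge0 ?ltW.
  have -> : k * (rnorm x - b / (2 * k)) ^+ 2 =
    k * rnorm x ^+ 2 - b * rnorm x + b ^+ 2 / (4 * k) by field; rewrite gt_eqF.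
  by move=> *; lra.
pose m := inf (range F).
pose E n := [set x | F x <= m + n.+1%:R^-1].
have mle x : m <= F x by apply: ge_inf; [case: FinfS|exists x].
(* the radius makes k s^2 - b s - d exceed |m| + 1 for every larger s *)
have [|||u [p [Eu up _]]] := @min_norm_nested E (1 + (`|b| + `|d| + `|m| + 1) / k).
- move=> n x /le_trans; apply; rewrite lerD2l lef_pV2 ?posrE // ler_nat //.
- by move=> n x y; apply: Fmid.
- move=> n; have [|_ [x _ <-] xl] := @inf_adherent _ (range F) n.+1%:R^-1 _ FinfS.
    by rewrite invr_gt0.
  exists x; first exact: ltW.
  have : F x <= m + 1.
    by apply: le_trans (ltW xl) _; rewrite lerD2l invf_le1// ler1n.
  have h1 := Fco x => h2; rewrite leNgt; apply/negP => xr.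
  set X := rnorm x in h1 xr.
  have X1 : 1 < X.
    by apply: le_lt_trans xr; rewrite lerDl divr_ge0 ?(ltW k0)// !addr_ge0.
  have : (`|b| + `|d| + `|m| + 1) < k * X.
    rewrite mulrC -ltr_pdivrMr//; apply: le_lt_trans xr; lra.
  have := ler_norm b; have := ler_norm d; have := ler_norm m.
  have := normr_ge0 b; have := normr_ge0 d; have := normr_ge0 m.
  by move: h1 h2; move: `|b| `|d| `|m| (F x) => *; nra.
exists p => y; apply: le_trans (mle y).
have h1 := Fcont _ _ up.
have h2 : (fun n => m + n.+1%:R^-1) @ \oo --> m.
  rewrite -[X in _ --> X]addr0; apply: cvgD; [exact: cvg_cst|exact: cvg_harmonic].
rewrite -(cvg_lim _ h1)// -(cvg_lim _ h2)//.
apply: ler_lim; [exact: cvgP h1|exact: cvgP h2|].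
by near=> n; exact: Eu.
Unshelve. all: by end_near. Qed.

End Minimisation.

(** * Bounded selfadjoint operators and their quadratic forms *)

Section Operators.
Context (R : realType) (H : completeNormedModType R[i]).
Context (ip : {dot H for Num.conj}).
Context (normH : norm_of_inner_product ip).
Implicit Types (x y z : H) (r t M : R) (T S X A B : H -> H).

Lemma linD T : linear T -> forall x y, T (x + y) = T x + T y.
Proof. by move=> lT x y; rewrite -{1}[x]scale1r lT scale1r. Qed.

Lemma lin0 T : linear T -> T 0 = 0.
Proof. by move=> lT; have := lT (-1) 0 0; rewrite scaler0 addr0 scaleN1r addNr. Qed.

Lemma linZ T : linear T -> forall a x, T (a *: x) = a *: T x.
Proof. by move=> lT a x; rewrite -[a *: x]addr0 lT lin0 // addr0. Qed.

Lemma linN T : linear T -> forall x, T (- x) = - T x.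
Proof. by move=> lT x; rewrite -scaleN1r linZ // scaleN1r. Qed.

Lemma linB T : linear T -> forall x y, T (x - y) = T x - T y.
Proof. by move=> lT x y; rewrite linD // linN. Qed.

Lemma Im_ip_conj x y : complex.Im (ip x y) = - complex.Im (ip y x).
Proof.
have := Im_conj (ip y x); rewrite -!complexIm -rmorphN => /complexI <-.
by rewrite (@hermC _ _ _ _ ip) expr0 mul1r.
Qed.

(** Replacing [x] by ['i *: x] exchanges real and imaginary parts, so one of the
    two is enough. *)
Lemma selfadjoint_of_Im T : linear T ->
  (forall x y, complex.Im (ip (T x) y) = complex.Im (ip x (T y))) ->
  selfadjoint ip T.
Proof.
move=> lT h x y; apply/eqP; rewrite eq_complex h eqxx andbT.
have := h ('i%C *: x) y.
rewrite linZ // !linearZl_LR.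
by rewrite !(mulrC 'i%C) !ImiRe => e; apply/eqP.
Qed.

Lemma selfadjoint_of_rdot T : linear T ->
  (forall x y, rdot ip (T x) y = rdot ip x (T y)) -> selfadjoint ip T.
Proof.
move=> lT h; apply: selfadjoint_of_Im => // x y.
have := h ('i%C *: x) y; rewrite /rdot.
rewrite linZ // !linearZl_LR.
by rewrite !(mulrC 'i%C) !ReiNIm => /oppr_inj.
Qed.

(** Over the complex numbers positivity forces symmetry: the imaginary part of
    <T(x+y), x+y> vanishes, and expands into that of <T x, y> + <T y, x>. *)
Lemma psd_selfadjoint T : linear T -> positive_semidefinite ip T -> selfadjoint ip T.
Proof.
move=> lT pT; apply: selfadjoint_of_Im => // x y.
have := ger0_Im (pT (x + y)); rewrite linD // linearDl !linearDr !raddfD /=.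
by rewrite (ger0_Im (pT x)) (ger0_Im (pT y)) (Im_ip_conj (T y)); lra.
Qed.

Lemma psd_of_qform T : selfadjoint ip T -> (forall x, 0 <= qform ip T x) ->
  positive_semidefinite ip T.
Proof.
move=> sT qT x; rewrite lecE (qT x) andbT /=.
by have := Im_ip_conj (T x) x; rewrite -sT; lra.
Qed.

Lemma qform_ge0 T x : positive_semidefinite ip T -> 0 <= qform ip T x.
Proof. by move=> /(_ x); rewrite lecE => /andP[]. Qed.

Record bounded_selfadjoint T M : Prop := BoundedSelfadjoint {
  bs_linear : linear T;
  bs_selfadjoint : selfadjoint ip T;
  bs_gt0 : 0 < M;
  bs_le : forall x, rnorm (T x) <= M * rnorm x }.

Lemma bounded_rnorm T : bounded_operator T ->
  linear T /\ exists2 M, 0 < M & forall x, rnorm (T x) <= M * rnorm x.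
Proof.
move=> [lT bT]; split=> //.
pose f : {linear H -> H} := HB.pack T (GRing.isLinear.Build _ _ _ _ T lT).
have /linear_boundedP /pinfty_ex_gt0 [[M c]] : bounded_near f (nbhs 0) by [].
rewrite ltcE /= => /andP[/eqP-> M0] h.
exists M => // x; have := h x; rewrite /= !normE -[M +i* 0]/(M%:C) -rmorphM.
by rewrite lecR.
Qed.

Lemma bounded_operatorI T M : linear T -> (forall x, rnorm (T x) <= M * rnorm x) ->
  bounded_operator T.
Proof.
move=> lT bT; split=> //.
pose f : {linear H -> H} := HB.pack T (GRing.isLinear.Build _ _ _ _ T lT).
apply/(linear_boundedP f); near=> s => x /=.
have Ms : M%:C <= s by near: s; apply: nbhs_pinfty_ge; rewrite complex_real.
apply: le_trans (ler_wpM2r (normr_ge0 x) Ms).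
by rewrite !normE -rmorphM lecR.
Unshelve. all: by end_near. Qed.

Lemma bounded_selfadjointI T : bounded_operator T -> selfadjoint ip T ->
  exists M, bounded_selfadjoint T M.
Proof. by move=> /bounded_rnorm[lT [M M0 hM]] sT; exists M. Qed.

Lemma rdot_sa T x y : selfadjoint ip T -> rdot ip (T x) y = rdot ip x (T y).
Proof. by move=> sT; rewrite /rdot sT. Qed.

Lemma qformD T : linear T -> selfadjoint ip T -> forall x y,
  qform ip T (x + y) = qform ip T x + 2 * rdot ip (T x) y + qform ip T y.
Proof.
move=> lT sT x y; rewrite /qform -!/(rdot _ _ _) linD // !rdotE.
by rewrite (rdot_sa y x sT) (rdotC ip y); ring.
Qed.

Lemma qformZ T : linear T -> forall r x, qform ip T (r%:C *: x) = r ^+ 2 * qform ip T x.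
Proof.
by move=> lT r x; rewrite /qform -!/(rdot _ _ _) linZ // !rdotE; ring.
Qed.

Lemma qform_pencil A B r x :
  qform ip (pencil A B r) x = qform ip A x + r * qform ip B x.
Proof. by rewrite /qform -!/(rdot _ _ _) /pencil !rdotE. Qed.

Lemma linear_ncvg T M u p : linear T -> (forall x, rnorm (T x) <= M * rnorm x) ->
  ncvg u p -> ncvg (fun n => T (u n)) (T p).
Proof.
move=> lT bT up; apply: (@ncvg_le _ _ _ _ (fun n => M * rnorm (u n - p))).
  by move=> n; rewrite -linB.
by rewrite -[0](mulr0 M); apply: cvgM => //; exact: cvg_cst.
Qed.

Lemma pencil_bounded_selfadjoint A B MA MB r : bounded_selfadjoint A MA ->
  bounded_selfadjoint B MB -> bounded_selfadjoint (pencil A B r) (MA + `|r| * MB).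
Proof.
move=> [lA sA MA0 bA] [lB sB MB0 bB]; split.
- move=> a x y; rewrite /pencil lA lB scalerDr scalerDr !scalerA addrACA.
  by rewrite mulrC.
- apply: selfadjoint_of_rdot => [a x y|x y].
    by rewrite /pencil lA lB scalerDr scalerDr !scalerA addrACA mulrC.
  by rewrite /pencil !rdotE !rdot_sa.
- by rewrite ltr_wpDr// mulr_ge0// ltW.
- move=> x; apply: le_trans (rnormD _ _) _; rewrite rnormZ mulrDl -mulrA.
  by rewrite lerD// ler_wpM2l.
Qed.

(** Positivity of the form at x - T x / M, the minimiser of the bound
    q(x) - 2 t |T x|^2 + t^2 M |T x|^2 over t. *)
Lemma psd_image_le T M x : bounded_selfadjoint T M -> positive_semidefinite ip T ->
  rnorm (T x) ^+ 2 <= M * qform ip T x.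
Proof.
move=> [lT sT M0 bT] pT.
have := qform_ge0 (x + (- M^-1)%:C *: T x) pT.
rewrite qformD // qformZ // rdotZr (rdotxx normH).
have : qform ip T (T x) <= M * rnorm (T x) ^+ 2.
  apply: le_trans (ler_norm _) _; apply: le_trans (rdot_le normH _ _) _.
  by rewrite expr2 mulrA ler_wpM2r ?rnorm_ge0.
rewrite -(ler_pM2l (x := M^-1 ^+ 2)) ?exprn_gt0 ?invr_gt0//.
set q := qform ip T x; set q2 := qform ip T (T x); set N := rnorm (T x) ^+ 2.
have -> : M^-1 ^+ 2 * (M * N) = M^-1 * N by field; rewrite gt_eqF.
rewrite sqrrN => h1 h2.
have : 0 <= M * (q - M^-1 * N) by rewrite pmulr_rge0//; lra.
by rewrite mulrBr mulrA divff ?gt_eqF// mul1r subr_ge0.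
Qed.

Lemma psd_kernel T M x : bounded_selfadjoint T M -> positive_semidefinite ip T ->
  qform ip T x = 0 -> T x = 0.
Proof.
move=> bT pT q0; have := psd_image_le x bT pT; rewrite q0 mulr0 => h.
by apply: rnorm_eq0; apply/eqP; rewrite -sqrf_eq0 eq_le h sqr_ge0.
Qed.

End Operators.

(** * Square roots of positive operators *)

Section SquareRoot.
Context (R : realType) (H : completeNormedModType R[i]).
Context (ip : {dot H for Num.conj}).
Context (normH : norm_of_inner_product ip).
Implicit Types (x y z : H) (r t M : R) (T S X A B : H -> H).

(** If Y solves 2 Y = X + Y^2, then (1 - Y)^2 = 1 - X. For a contraction X the
    equation is solved by iteration from 0. *)
Fixpoint sqrt_iter X n : H -> H :=
  if n is m.+1 then fun x => (2^-1)%:C *: (X x + sqrt_iter X m (sqrt_iter X m x))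
  else fun=> 0.

(** The same iteration for the scalar X = 1: it increases to a limit and dominates
    the norms of the iterates and of their increments, hence their convergence. *)
Fixpoint sqrt_bound n : R :=
  if n is m.+1 then 2^-1 * (1 + sqrt_bound m ^+ 2) else 0.

Lemma sqrt_bound_ge0_le1 n : 0 <= sqrt_bound n <= 1.
Proof. by elim: n => [|n /= /andP[h0 h1]]; [rewrite lexx ler01|nra]. Qed.

Lemma sqrt_bound_nd : nondecreasing_seq sqrt_bound.
Proof.
apply/nondecreasing_seqP => n.
by have := sqr_ge0 (1 - sqrt_bound n); rewrite /=; lra.
Qed.

Section Contraction.
Variables (X : H -> H).
Context (lX : linear X) (sX : selfadjoint ip X).
Context (X1 : forall x, rnorm (X x) <= rnorm x).

Lemma sqrt_iter_linear n : linear (sqrt_iter X n).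
Proof.
elim: n => [|n IH] a x y /=; first by rewrite scaler0 addr0.
rewrite lX !IH scalerA mulrC -scalerA -scalerDr; congr (_ *: _).
by rewrite scalerDr addrACA.
Qed.

Lemma sqrt_iter_rdot n x y :
  rdot ip (sqrt_iter X n x) y = rdot ip x (sqrt_iter X n y).
Proof.
elim: n x y => [|n IH] x y /=.
  by rewrite -(scale0r (0 : H)) (rdotZl ip 0 0) (rdotZr ip 0) !mul0r.
by rewrite !rdotE (rdot_sa x y sX) !IH.
Qed.

Lemma sqrt_iter_le n x : rnorm (sqrt_iter X n x) <= sqrt_bound n * rnorm x.
Proof.
elim: n x => [|n IH] x /=; first by rewrite rnorm0 mul0r.
rewrite rnormZ ger0_norm ?invr_ge0// -mulrA ler_wpM2l ?invr_ge0//.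
apply: le_trans (rnormD _ _) _; rewrite mulrDl mul1r lerD//.
apply: le_trans (IH _) _; rewrite expr2 -mulrA.
by have /andP[? _] := sqrt_bound_ge0_le1 n; rewrite ler_wpM2l.
Qed.

(** Twice the next increment is Y1^2 - Y0^2 = Y1 (Y1 - Y0) + (Y1 - Y0) Y0, and the
    scalar increments satisfy the same recursion. *)
Lemma sqrt_iter_step n x : rnorm (sqrt_iter X n.+1 x - sqrt_iter X n x) <=
  (sqrt_bound n.+1 - sqrt_bound n) * rnorm x.
Proof.
elim: n x => [|n IH] x.
  rewrite /= addr0 subr0 rnormZ subr0 ger0_norm ?invr_ge0// expr0n addr0 mulr1.
  by rewrite ler_wpM2l ?invr_ge0.
set Y1 := sqrt_iter X n.+1; set Y0 := sqrt_iter X n.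
set r1 := sqrt_bound n.+1; set r0 := sqrt_bound n.
have -> : sqrt_iter X n.+2 x - Y1 x = (2^-1)%:C *: (Y1 (Y1 x - Y0 x) + (Y1 (Y0 x) - Y0 (Y0 x))).
  have lY1 : linear Y1 := sqrt_iter_linear n.+1.
  rewrite (linB lY1) addrA subrK.
  by rewrite {2}/Y1 /= -scalerBr opprD addrACA subrr add0r.
have -> : sqrt_bound n.+2 - r1 = 2^-1 * (r1 * (r1 - r0) + (r1 - r0) * r0).
  have r1E : r1 = 2^-1 * (1 + r0 ^+ 2) by [].
  have -> : sqrt_bound n.+2 = 2^-1 * (1 + r1 ^+ 2) by [].
  by rewrite r1E; field.
rewrite rnormZ ger0_norm ?invr_ge0// -mulrA ler_wpM2l ?invr_ge0//.
have /andP[r10 _] := sqrt_bound_ge0_le1 n.+1.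
have r01 : 0 <= r1 - r0 by rewrite subr_ge0; exact: sqrt_bound_nd.
apply: le_trans (rnormD _ _) _; rewrite mulrDl; apply: lerD.
  by apply: le_trans (sqrt_iter_le _ _) _; rewrite -mulrA ler_wpM2l// IH.
apply: le_trans (IH _) _; rewrite -mulrA ler_wpM2l//.
exact: sqrt_iter_le.
Qed.

Lemma sqrt_iter_dist m n x : (n <= m)%N ->
  rnorm (sqrt_iter X m x - sqrt_iter X n x) <= (sqrt_bound m - sqrt_bound n) * rnorm x.
Proof.
elim: m => [|m IH]; first by rewrite leqn0 => /eqP->; rewrite !subrr rnorm0 mul0r.
rewrite leq_eqVlt => /predU1P[->|]; first by rewrite !subrr rnorm0 mul0r.
rewrite ltnS => /IH h.
rewrite -[_ - sqrt_iter X n x](subrKA (sqrt_iter X m x)).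
rewrite -[_ - sqrt_bound n](subrKA (sqrt_bound m)) mulrDl.
by apply: le_trans (rnormD _ _) _; apply: lerD => //; exact: sqrt_iter_step.
Qed.

Lemma sqrt_iter_cvg x : exists y, ncvg (fun n => sqrt_iter X n x) y.
Proof.
have bcv : cvgn sqrt_bound.
  apply: nondecreasing_is_cvgn; first exact: sqrt_bound_nd.
  by exists 1 => _ [n _ <-]; have /andP[] := sqrt_bound_ge0_le1 n.
set D : R := limn sqrt_bound in bcv *.
have bD n : sqrt_bound n <= D by apply: nondecreasing_cvgn_le => //; exact: sqrt_bound_nd.
apply: rnorm_complete => e e0.
pose c n := 2 * (D - sqrt_bound n) * rnorm x.
have c0 : c @ \oo --> 0.
  rewrite (_ : 0 = 2 * (D - D) * rnorm x); last by rewrite subrr mulr0 mul0r.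
  apply: cvgM; last exact: cvg_cst.
  by apply: cvgM; [exact: cvg_cst|apply: cvgB => //; exact: cvg_cst].
have [N _ /(_ N (leqnn N)) cN] := (cvgr0Pnorm_lt c).1 c0 _ e0.
exists N => m n Nm Nn; apply: le_lt_trans cN; apply: le_trans (ler_norm _).
rewrite -[_ - sqrt_iter X n x](subrKA (sqrt_iter X N x)).
apply: le_trans (rnormD _ _) _; rewrite -(rnormN (sqrt_iter X N x - _)) opprB.
apply: le_trans (lerD (sqrt_iter_dist _ Nm) (sqrt_iter_dist _ Nn)) _.
rewrite -mulrDl /c ler_wpM2r ?rnorm_ge0//.
by have := bD m; have := bD n => *; lra.
Qed.

Lemma contraction_sqrt : exists S, [/\ bounded_operator S, positive_semidefinite ip S
  & forall x, S (S x) = x - X x].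
Proof.
have /choice[Y Ycv] := sqrt_iter_cvg.
have lY : linear Y.
  move=> a x y; apply: (ncvg_unique (Ycv _)).
  have -> : (fun n => sqrt_iter X n (a *: x + y)) =
            (fun n => a *: sqrt_iter X n x + sqrt_iter X n y).
    by apply/funext => n; rewrite sqrt_iter_linear.
  apply: ncvgD (Ycv y).
  apply: (@ncvg_le _ _ _ _ (fun n => complex.Re `|a| * rnorm (sqrt_iter X n x - Y x))).
    move=> n; rewrite -scalerBr /rnorm normrZ [`|_ - _|]normE.
    by case: (`|a|) => u v /=; rewrite mulr0 subr0.
  by rewrite -[0](mulr0 (complex.Re `|a|)); apply: cvgM (Ycv x); exact: cvg_cst.
have rY x y : rdot ip (Y x) y = rdot ip x (Y y).
  have h1 := ncvg_rdot normH (Ycv x) (ncvg_cst y).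
  have h2 := ncvg_rdot normH (ncvg_cst x) (Ycv y).
  rewrite -(cvg_lim _ h2)//; apply/esym/cvg_lim => //.
  by under eq_fun do rewrite -sqrt_iter_rdot.
have sY : selfadjoint ip Y by exact: selfadjoint_of_rdot.
have iter1 n x : rnorm (sqrt_iter X n x) <= rnorm x.
  apply: le_trans (sqrt_iter_le n x) _; rewrite ler_piMl ?rnorm_ge0//.
  by have /andP[] := sqrt_bound_ge0_le1 n.
have Y1 x : rnorm (Y x) <= rnorm x.
  have h1 := ncvg_rnorm normH (Ycv x).
  rewrite -(cvg_lim _ h1)//; apply: limr_le; first exact: cvgP h1.
  by near=> n; exact: iter1.
have YY x : Y (Y x) = 2%:C *: Y x - X x.
  apply: (@ncvg_unique _ _ (fun n => sqrt_iter X n (sqrt_iter X n x))).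
    apply: (@ncvg_le _ _ _ _ (fun n => rnorm (sqrt_iter X n x - Y x)
                               + rnorm (sqrt_iter X n (Y x) - Y (Y x)))).
      move=> n; rewrite -[_ - Y (Y x)](subrKA (sqrt_iter X n (Y x))).
      apply: le_trans (rnormD _ _) _; rewrite lerD2r.
      by rewrite -(linB (sqrt_iter_linear n)).
    by rewrite -[0]addr0; apply: cvgD; exact: Ycv.
  have -> : (fun n => sqrt_iter X n (sqrt_iter X n x)) =
            (fun n => 2%:C *: sqrt_iter X n.+1 x + - X x).
    apply/funext => n; rewrite /= scalerA -rmorphM divff ?pnatr_eq0//.
    by rewrite rmorph1 scale1r [X x + _]addrC addrK.
  apply: ncvgD (ncvg_cst _); apply: ncvgZ; first exact: cvg_cst.
  by have := Ycv x; rewrite /ncvg -cvg_shiftS.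
have lS : linear (fun x => x - Y x).
  by move=> a x y; rewrite lY opprD scalerBr addrACA.
exists (fun x => x - Y x); split.
- apply: (@bounded_operatorI _ _ _ 2) => [//|x].
  by apply: le_trans (rnormD _ _) _; rewrite rnormN; have := Y1 x; lra.
- apply: psd_of_qform => [|x].
    by apply: selfadjoint_of_rdot => // x y; rewrite !rdotE rY.
  rewrite /qform -/(rdot _ _ _) !rdotE (rdotxx normH) subr_ge0.
  apply: le_trans (ler_norm _) _; apply: le_trans (rdot_le normH _ _) _.
  by rewrite expr2 ler_wpM2r ?rnorm_ge0.
- move=> x; rewrite (linB lY) YY.
  rewrite (_ : 2%:C = 1 + 1) ?scalerDl ?scale1r; last by rewrite rmorphD.
  by rewrite opprB [_ + Y x - X x - Y x]addrAC addrK subrKA.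
Unshelve. all: by end_near. Qed.

End Contraction.

(** For 0 <= T <= M, the operator X = 1 - T / M is a contraction, and
    T = M (1 - X). *)
Lemma psd_sqrt T M : bounded_selfadjoint ip T M -> positive_semidefinite ip T ->
  exists S, [/\ bounded_operator S, positive_semidefinite ip S
  & forall x, S (S x) = T x].
Proof.
move=> bT pT; have [lT sT M0 leT] := bT.
pose X x := x - (M^-1)%:C *: T x.
have lX : linear X.
  move=> a x y; rewrite /X lT scalerDr scalerA mulrC -scalerA opprD scalerBr.
  by rewrite addrACA.
have sX : selfadjoint ip X.
  by apply: selfadjoint_of_rdot => // x y; rewrite /X !rdotE (rdot_sa x y sT).
have X1 x : rnorm (X x) <= rnorm x.
  rewrite -ler_sqr ?nnegrE ?rnorm_ge0// -!(rdotxx normH) /X !rdotE.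
  rewrite (rdotC ip x) -[rdot ip (T x) x]/(qform ip T x) !(rdotxx normH).
  have q0 := qform_ge0 x pT.
  have Mq : 0 <= M^-1 * qform ip T x by rewrite mulr_ge0// invr_ge0 ltW.
  have : M^-1 ^+ 2 * rnorm (T x) ^+ 2 <= M^-1 * qform ip T x.
    have := psd_image_le normH x bT pT.
    rewrite -(ler_pM2l (x := M^-1 ^+ 2)) ?exprn_gt0 ?invr_gt0// => /le_trans; apply.
    by rewrite expr2 -!mulrA mulKf ?gt_eqF.
  by rewrite expr2 => *; lra.
have [S [bS pS SS]] := contraction_sqrt lX sX X1.
have [lS [K K0 hK]] := bounded_rnorm bS.
have sM : 0 <= Num.sqrt M by exact: sqrtr_ge0.
exists (fun x => (Num.sqrt M)%:C *: S x); split.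
- apply: (@bounded_operatorI _ _ _ (Num.sqrt M * K)) => [a x y|x].
    by rewrite lS scalerDr scalerA mulrC -scalerA.
  by rewrite rnormZ ger0_norm// -mulrA ler_wpM2l.
- by move=> x; rewrite linearZl_LR /= mulr_ge0// ler0c.
- move=> x; rewrite (linZ lS) SS scalerA -rmorphM -expr2 sqr_sqrtr ?ltW//.
  by rewrite /X opprB addrC subrK scalerA -rmorphM divff ?gt_eqF// rmorph1 scale1r.
Qed.

End SquareRoot.

(** * Ranges of injective and of surjective operators *)

Section Range.
Context (R : realType) (H : completeNormedModType R[i]).
Context (ip : {dot H for Num.conj}).
Context (normH : norm_of_inner_product ip).
Implicit Types (x y z : H) (r t M : R) (T S X A B : H -> H).

Lemma linear_term_eq0 (d N : R) : 0 <= N ->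
  (forall t, 0 <= 2 * t * d + t ^+ 2 * N) -> d = 0.
Proof.
(* the minimiser is - d / N; N + 1 avoids the division by N = 0 *)
move=> N0 /(_ (- d / (N + 1))).
have N1 : 0 < (N + 1) ^+ 2 by rewrite exprn_gt0// ltr_wpDl.
have -> : 2 * (- d / (N + 1)) * d + (- d / (N + 1)) ^+ 2 * N =
  - (d ^+ 2 * (N + 2)) / (N + 1) ^+ 2 by field; rewrite gt_eqF// ltr_wpDl.
rewrite pmulr_lge0 ?invr_gt0// oppr_ge0 pmulr_lle0 ?ltr_wpDl//.
by move=> h; apply/eqP; rewrite -sqrf_eq0 eq_le h sqr_ge0.
Qed.

(** The shortest limit [p] of the vectors S x - a is orthogonal to the range of S,
    so S p = 0 by symmetry and p = 0 by injectivity. *)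
Lemma dense_range S : linear S -> selfadjoint ip S -> (forall x, S x = 0 -> x = 0) ->
  forall a, exists u, ncvg (fun n => S (u n)) a.
Proof.
move=> lS sS injS a.
pose E := [set S x - a | x in [set: H]].
have Emid x y : E x -> E y -> E (midpoint x y).
  move=> [x' _ <-] [y' _ <-]; exists (midpoint x' y') => //.
  have aa : a = (2^-1)%:C *: (a + a).
    rewrite -mulr2n -(scaler_nat 2 a) scalerA -(rmorph_nat (real_complex R)).
    by rewrite -rmorphM mulVf ?pnatr_eq0// rmorph1 scale1r.
  by rewrite /midpoint linZ // linD // {1}aa -scalerBr opprD addrACA.
have [|w [p [Ew wp pmin]]] := @min_norm_nested _ _ _ normH (fun=> E)
    (rnorm (S 0 - a)) (fun _ _ => id) (fun=> Emid).
  by move=> _; exists (S 0 - a) => //; exists 0.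
have pE e : E e -> rnorm p <= rnorm e by move=> Ee; apply: pmin => _; exists e.
have p0 : p = 0.
  apply: injS; apply: (rdotxx_eq0 normH); rewrite (rdot_sa p (S p) sS).
  apply: (@linear_term_eq0 _ (rnorm (S (S p)) ^+ 2)); first exact: sqr_ge0.
  move=> t; set h := S (S p).
  have h1 := ncvg_rnorm normH (ncvgD wp (ncvg_cst (t%:C *: h))).
  have : rnorm p <= rnorm (p + t%:C *: h).
    rewrite -(cvg_lim _ h1)//; apply: limr_ge; first exact: cvgP h1.
    near=> n; apply: pE; have [x _ <-] := Ew n.
    by exists (x + t%:C *: S p) => //; rewrite linD // linZ // addrAC.
  rewrite -ler_sqr ?nnegrE ?rnorm_ge0// -!(rdotxx normH) !rdotE (rdotC ip h p).
  by move=> *; nra.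
have /choice[u uw] n : exists x, S x - a = w n by have [x _ <-] := Ew n; exists x.
exists u; move: wp; rewrite p0 /ncvg.
by under eq_fun do rewrite subr0 -uw.
Unshelve. all: by end_near. Qed.

(** Gliding hump: the sign of the n-th term is chosen so that the inner product
    with z_n does not lose size when 3^-n z_n is added. *)
Fixpoint hump (z : nat -> H) n : H :=
  if n is m.+1 then
    hump z m + ((if 0 <= rdot ip (hump z m) (z m) then 1 else -1) * 3^-1 ^+ m)%:C *: z m
  else 0.

(** Otherwise there are unit vectors z_n with |T z_n| <= 3^-n / (n + 1). The limit w
    of the gliding hump series has |<w, z_n>| >= 3^-n / 2, as the later terms
    contribute at most that much. But w = T x gives
    |<w, z_n>| = |<x, T z_n>| <= |x| 3^-n / (n + 1), impossible for large n. *)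
Lemma surjective_coercive T M : bounded_selfadjoint ip T M ->
  positive_semidefinite ip T -> (forall y, exists x, T x = y) ->
  exists2 k, 0 < k & forall x, k * rnorm x ^+ 2 <= qform ip T x.
Proof.
move=> bT pT surT; have [lT sT M0 _] := bT.
apply: contrapT => ncoer.
have small (e : R) : 0 < e -> exists z, rnorm z = 1 /\ rnorm (T z) <= e.
  move=> e0; apply: contrapT => nz; apply: ncoer; exists (e ^+ 2 / M).
    by rewrite divr_gt0// exprn_gt0.
  move=> x; have [->|x0] := eqVneq x 0.
    by rewrite rnorm0 expr0n mulr0 qform_ge0.
  have nx : rnorm x != 0 by apply: contra_neq x0 => /rnorm_eq0.
  have nx0 : 0 < rnorm x by rewrite lt_def nx rnorm_ge0.
  have h : e * rnorm x <= rnorm (T x).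
    rewrite leNgt; apply/negP => lt; apply: nz.
    exists ((rnorm x)^-1%:C *: x); rewrite linZ// !rnormZ ger0_norm ?invr_ge0 ?rnorm_ge0//.
    by rewrite mulVf//; split=> //; rewrite mulrC ler_pdivrMr// ltW.
  rewrite mulrAC ler_pdivrMr// mulrC -exprMn [X in _ <= X]mulrC.
  apply: le_trans (psd_image_le normH x bT pT).
  by rewrite mulrC ler_sqr ?nnegrE ?rnorm_ge0// mulr_ge0 ?rnorm_ge0// ltW.
have /choice[z zP] n : exists z, rnorm z = 1 /\ rnorm (T z) <= 3^-1 ^+ n / n.+1%:R.
  by apply: small; rewrite divr_gt0// exprn_gt0// invr_gt0.
pose y := hump z; pose c n : R := 3^-1 ^+ n.
have c0 n : 0 < c n by rewrite exprn_gt0// invr_gt0.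
have cS n : c n.+1 = 3^-1 * c n by rewrite /c exprS.
have yS n : rnorm (y n.+1 - y n) = c n.
  rewrite /= addrAC subrr add0r rnormZ (zP n).1 mulr1 normrM (ger0_norm (ltW (c0 n))).
  by case: ifP; rewrite ?normrN normr1 mul1r.
have yd n : c n <= `|rdot ip (y n.+1) (z n)|.
  rewrite /= rdotDl rdotZl (rdotxx normH) (zP n).1 expr1n mulr1.
  have := c0 n; case: ifPn => [d0 cn|]; first by rewrite ger0_norm; rewrite /c in cn *; lra.
  by rewrite -ltNge => d0 cn; rewrite ler0_norm; rewrite /c in cn *; lra.
have yy n m : rnorm (y (m + n)%N - y n) <= 3 / 2 * (c n - c (m + n)%N).
  elim: m => [|m IH]; first by rewrite !subrr rnorm0 mulr0.
  rewrite addSn -[_ - y n](subrKA (y (m + n)%N)).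
  apply: le_trans (rnormD _ _) _; rewrite yS cS; lra.
have yyle n m : (n <= m)%N -> rnorm (y m - y n) <= 3 / 2 * c n.
  move=> /subnK <-; apply: le_trans (yy _ _) _.
  by rewrite ler_pM2l ?divr_gt0// lerBlDr lerDl ltW.
have ccvg : c @ \oo --> 0.
  by apply: cvg_expr; rewrite ger0_norm ?invr_ge0// invf_lt1// ltr1n.
have [w wy] : exists w, ncvg y w.
  apply: rnorm_complete => e e0.
  have e3 : 0 < e / 3 by rewrite divr_gt0.
  have [N _ /(_ N (leqnn N)) cN] := (cvgr0Pnorm_lt c).1 ccvg _ e3.
  exists N => m n Nm Nn; rewrite -[_ - y n](subrKA (y N)).
  apply: le_lt_trans (rnormD _ _) _; rewrite -(rnormN (y N - y n)) opprB.
  have := yyle _ _ Nm; have := yyle _ _ Nn; move: cN; rewrite (ger0_norm (ltW (c0 N))) => *; lra.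
have wyle n : rnorm (w - y n) <= 3 / 2 * c n.
  have h1 := ncvg_rnorm normH (ncvgD wy (ncvg_cst (- y n))).
  rewrite -(cvg_lim _ h1)//; apply: limr_le; first exact: cvgP h1.
  by near=> m; apply: yyle; near: m; exact: nbhs_infty_ge.
have [x Tx] := surT w.
have key n : n.+1%:R <= 2 * rnorm x.
  have h1 : `|rdot ip w (z n)| <= rnorm x * (c n / n.+1%:R).
    rewrite -Tx (rdot_sa x (z n) sT); apply: le_trans (rdot_le normH _ _) _.
    by rewrite ler_wpM2l ?rnorm_ge0//; case: (zP n).
  have h2 : `|rdot ip (w - y n.+1) (z n)| <= 2^-1 * c n.
    apply: le_trans (rdot_le normH _ _) _; rewrite (zP n).1 mulr1.
    by apply: le_trans (wyle _) _; rewrite cS; lra.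
  have h3 : 2^-1 * c n <= `|rdot ip w (z n)|.
    have := yd n; have := ler_normB (rdot ip w (z n)) (rdot ip (w - y n.+1) (z n)).
    rewrite -[_ - _]/(_ + _) -rdotNl -rdotDl opprB addrC subrK => *; lra.
  have := le_trans h3 h1.
  rewrite [rnorm x * _]mulrA -(ler_pM2r (x := n.+1%:R))// divfK ?pnatr_eq0//.
  by rewrite mulrAC ler_pM2r//; lra.
have [n hn] : exists n : nat, 2 * rnorm x < n%:R.
  by exists (Num.bound (2 * rnorm x)); apply: archi_boundP; rewrite mulr_ge0 ?rnorm_ge0.
have := key n; rewrite leNgt => /negP; apply; apply: lt_trans hn _.
by rewrite ltr_nat.
Unshelve. all: by end_near. Qed.

End Range.

(** * Closest points in the image of a level set *)

Section ClosestPoints.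
Context (R : realType) (H : completeNormedModType R[i]).
Context (ip : {dot H for Num.conj}).
Context (normH : norm_of_inner_product ip).
Implicit Types (x y z u v : H) (r t M : R) (T S X A B : H -> H).

(** A quadratic that starts at [c] and bends towards [beta] reaches it at some
    t >= 0: the discriminant is at least p^2. *)
Lemma quadratic_root (c p q beta : R) : q != 0 -> (c - beta) * q <= 0 ->
  exists2 t, 0 <= t & c + 2 * p * t + q * t ^+ 2 = beta.
Proof.
move=> q0 cq.
pose D := p ^+ 2 - q * (c - beta).
have pD : p ^+ 2 <= D by rewrite /D; lra.
have D0 : 0 <= D by apply: le_trans pD; exact: sqr_ge0.
exists (- p / q + Num.sqrt D / `|q|).
  have : `|p| / `|q| <= Num.sqrt D / `|q|.
    by rewrite ler_pM2r ?invr_gt0 ?normr_gt0// -sqrtr_sqr ler_wsqrtr.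
  rewrite -normfV -normrM; have := ler_norm (p / q).
  by rewrite mulNr => *; lra.
have qq : q * (Num.sqrt D / `|q|) ^+ 2 = D / q.
  by rewrite exprMn exprVn sqr_sqrtr// -normrX ger0_norm ?sqr_ge0//; field.
set w := _ / `|q| in qq *.
have -> : c + 2 * p * (- p / q + w) + q * (- p / q + w) ^+ 2
  = c - p ^+ 2 / q + q * w ^+ 2 by field.
by rewrite qq /D; field.
Qed.

Section RelativelyBounded.
Context (B S : H -> H) (delta : R).
Context (lB : linear B) (sB : selfadjoint ip B) (lS : linear S).
Context (injS : forall x, S x = 0 -> x = 0) (delta0 : 0 < delta).
Context (BS : forall x, delta * `|qform ip B x| <= rnorm (S x) ^+ 2).

(** Polarisation bounds 2 delta <B x, y> by |S x|^2 + |S y|^2; scaling x and y to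
    equal |S .| turns the sum of squares into the product. *)
Lemma relative_rdot_le x y :
  delta * rdot ip (B x) y <= rnorm (S x) * rnorm (S y).
Proof.
have half u v : delta * (2 * rdot ip (B u) v) <= rnorm (S u) ^+ 2 + rnorm (S v) ^+ 2.
  have := BS (u + v); have := BS (u + (-1)%:C *: v).
  rewrite !(linD lS) (linZ lS) -!(rdotxx normH) !rdotE (rdotC ip (S v)).
  rewrite !qformD// qformZ// !rdotE.
  set q1 := qform ip B u; set q2 := qform ip B v; set d := rdot ip _ _ => h1 h2.
  have g1 := ler_norm (q1 + 2 * d + q2).
  have := ler_norm (- (q1 + 2 * (-1 * d) + (-1) ^+ 2 * q2)).
  rewrite normrN => g2.
  have := ler_wpM2l (ltW delta0) (lerD g1 g2).
  by move: h1 h2; move: `|_| `|_| => a b *; lra.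
have [Sx0|Sx0] := eqVneq (rnorm (S x)) 0.
  have -> : x = 0 by apply/injS/rnorm_eq0.
  by rewrite (lin0 lS) (lin0 lB) rnorm0 mul0r -(scale0r (0 : H)) (rdotZl ip 0) mul0r mulr0.
have [Sy0|Sy0] := eqVneq (rnorm (S y)) 0.
  have -> : y = 0 by apply/injS/rnorm_eq0.
  by rewrite (lin0 lS) rnorm0 mulr0 -(scale0r (0 : H)) (rdotZr ip 0) mul0r mulr0.
have X0 : 0 < rnorm (S x) by rewrite lt_def Sx0 rnorm_ge0.
have Y0 : 0 < rnorm (S y) by rewrite lt_def Sy0 rnorm_ge0.
have := half ((rnorm (S y))%:C *: x) ((rnorm (S x))%:C *: y).
rewrite !(linZ lS) (linZ lB) !rnormZ !rdotE !(ger0_norm (rnorm_ge0 _)).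
set X := rnorm (S x); set Y := rnorm (S y); set d := rdot ip _ _.
have -> : delta * (2 * (X * (Y * d))) = 2 * (X * Y) * (delta * d) by ring.
have -> : (Y * X) ^+ 2 + (X * Y) ^+ 2 = 2 * (X * Y) * (X * Y) by ring.
by rewrite ler_pM2l// !mulr_gt0.
Qed.

Lemma real_cauchy (c : nat -> R) :
  (forall e : R, 0 < e -> exists N, forall m n, (N <= m)%N -> (N <= n)%N ->
     c m - c n < e) -> cvgn c.
Proof.
move=> h; apply: cauchy_cvg; apply/cauchy_ballP => e e0.
have [N hN] := h _ e0.
exists ([set c n | n in [set n | (N <= n)%N]], [set c n | n in [set n | (N <= n)%N]]).
  by split; exists N => // n /= Nn; exists n.
move=> [_ _] [[m /= Nm <-] [n /= Nn <-]] /=.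
by rewrite -ball_normE /= lter_norml ltrNl opprB !hN.
Qed.

(** q_B extends continuously from the range of S to its closure: the difference of
    two values is <B (x - y), x + y>, controlled by |S x - S y|. *)
Lemma qform_cvg (x : nat -> H) a : ncvg (fun n => S (x n)) a ->
  cvgn (fun n => qform ip B (x n)).
Proof.
move=> xa; apply: real_cauchy => e e0.
pose K := rnorm a + 1.
have K0 : 0 < K by rewrite ltr_wpDl ?rnorm_ge0.
pose eta := Num.min 1 (delta * e / (5 * K)).
have eta0 : 0 < eta by rewrite lt_min ltr01 divr_gt0 ?mulr_gt0.
have eta1 : eta <= 1 by rewrite ge_min lexx.
have etae : 5 * K * eta <= delta * e.
  by rewrite mulrC -ler_pdivlMr ?mulr_gt0// ge_min lexx orbT.
have [N _ hN] := (ncvgP _ _).1 xa _ eta0.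
exists N => m n Nm Nn.
have hm := hN _ Nm; have hn := hN _ Nn; rewrite /= in hm hn.
have S1 : rnorm (S (x m - x n)) <= 2 * eta.
  rewrite (linB lS) -(subrKA a); apply: le_trans (rnormD _ _) _.
  by rewrite -(rnormN (a - _)) opprB; lra.
have S2 : rnorm (S (x m + x n)) <= 2 * K.
  rewrite (linD lS) (_ : _ + _ = (S (x m) - a) + (S (x n) - a) + (a + a)); last first.
    by rewrite addrACA !subrK.
  apply: le_trans (rnormD _ _) _; apply: le_trans (lerD (rnormD _ _) (rnormD _ _)) _.
  by rewrite /K; lra.
have -> : qform ip B (x m) - qform ip B (x n) = rdot ip (B (x m - x n)) (x m + x n).
  rewrite /qform -!/(rdot ip _ _) (linB lB) !rdotE (rdotC ip (B (x n)) (x m)).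
  by rewrite -(rdot_sa (x m) (x n) sB); ring.
rewrite -(ltr_pM2l delta0); apply: le_lt_trans (relative_rdot_le _ _) _.
apply: le_lt_trans (ler_pM (rnorm_ge0 _) (rnorm_ge0 _) S1 S2) _.
have : 0 < K * eta by rewrite mulr_gt0.
by lra.
Qed.

Lemma rdot_cvg v (x : nat -> H) a : ncvg (fun n => S (x n)) a ->
  cvgn (fun n => rdot ip (B v) (x n)).
Proof.
move=> xa.
have c1 := qform_cvg xa.
have xva : ncvg (fun n => S (v + x n)) (S v + a).
  by under eq_fun do rewrite (linD lS); apply: ncvgD => //; exact: ncvg_cst.
have c2 := qform_cvg xva.
rewrite (_ : (fun n => _) =
  fun n => 2^-1 * (qform ip B (v + x n) - qform ip B (x n) - qform ip B v)).
  apply: is_cvgM; first exact: is_cvg_cst.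
  by apply: is_cvgB; [exact: is_cvgB|exact: is_cvg_cst].
by apply/funext => n; rewrite qformD//; field.
Qed.

(** Two corrections: a fixed multiple of [u], after which the limit of q_B lies
    strictly above [beta], then a convergent multiple s_n of [v] solving
    q_B = beta. The strict inequality keeps the discriminant nonnegative for
    large n, and the explicit root formula makes s_n converge. *)
Lemma level_set_approx u v (x : nat -> H) a beta :
  0 < qform ip B u -> qform ip B v < 0 -> ncvg (fun n => S (x n)) a ->
  exists w (z : nat -> H) N, (forall n, (N <= n)%N -> qform ip B (z n) = beta) /\
    ncvg (fun n => S (z n)) (a + S w).
Proof.
move=> qu qv xa.
have qformDZ y t w : qform ip B (y + t%:C *: w) =
    qform ip B y + 2 * rdot ip (B w) y * t + qform ip B w * t ^+ 2.
  by rewrite qformD// qformZ// rdotZr (rdot_sa y w sB) (rdotC ip y); ring.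
have ncvgDZ t (y : nat -> H) b w : ncvg (fun n => S (y n)) b ->
    ncvg (fun n => S (y n + t%:C *: w)) (b + t%:C *: S w).
  move=> yb; under eq_fun do rewrite (linD lS) (linZ lS).
  by apply: ncvgD => //; exact: ncvg_cst.
have [/cvg_ex[c xc] /cvg_ex[p xp]] := (qform_cvg xa, rdot_cvg (v := u) xa).
have [T hT] : exists T : R, beta < c + 2 * p * T + qform ip B u * T ^+ 2.
  (* the root lemma needs a start below its target beta + 1, hence the min *)
  have [|T T0 e] := @quadratic_root (Num.min c beta) p (qform ip B u) (beta + 1)
     (lt0r_neq0 qu).
    by rewrite pmulr_lle0// subr_le0 ge_min lerDl ler01 orbT.
  exists T; have : Num.min c beta <= c by rewrite ge_min lexx.
  by move=> *; lra.
pose y n := x n + T%:C *: u.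
have ya : ncvg (fun n => S (y n)) (a + T%:C *: S u) by exact: ncvgDZ.
have [/cvg_ex[c' yc] /cvg_ex[p' yp]] := (qform_cvg ya, rdot_cvg (v := v) ya).
have lc : beta < c'.
  rewrite -(cvg_lim _ yc)//; under eq_fun do rewrite qformDZ.
  rewrite (_ : limn _ = c + 2 * p * T + qform ip B u * T ^+ 2)//.
  apply: cvg_lim => //; apply: cvgD; last exact: cvg_cst.
  apply: cvgD => //; apply: cvgM; last exact: cvg_cst.
  by apply: cvgM => //; exact: cvg_cst.
set q := qform ip B v in qv.
pose s n := (- rdot ip (B v) (y n) -
   Num.sqrt (rdot ip (B v) (y n) ^+ 2 - q * (qform ip B (y n) - beta))) / q.
have [N _ hN] : \forall n \near \oo, beta < qform ip B (y n) by exact: cvgr_gt yc _ lc.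
have sc : s @ \oo --> (- p' - Num.sqrt (p' ^+ 2 - q * (c' - beta))) / q.
  apply: cvgM; last exact: cvg_cst.
  apply: cvgB; first exact: cvgN.
  apply: continuous_cvg; first exact: sqrt_continuous.
  apply: cvgB; first by rewrite expr2; apply: cvgM.
  by apply: cvgM; [exact: cvg_cst|apply: cvgB => //; exact: cvg_cst].
set t := _ / q in sc.
exists (T%:C *: u + t%:C *: v), (fun n => y n + (s n)%:C *: v), N; split.
  move=> n /hN /= cn; rewrite qformDZ -/q /s.
  set P := rdot ip _ _; set D := P ^+ 2 - _; set C := qform ip B (y n) in cn D *.
  have D0 : 0 <= D.
    by rewrite subr_ge0 (le_trans _ (sqr_ge0 _))// nmulr_rle0// subr_ge0 ltW.
  have -> : C + 2 * P * ((- P - Num.sqrt D) / q) + q * ((- P - Num.sqrt D) / q) ^+ 2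
    = C + (Num.sqrt D ^+ 2 - P ^+ 2) / q by field; rewrite lt_eqF.
  by rewrite sqr_sqrtr// /D; field; rewrite lt_eqF.
under eq_fun do rewrite (linD lS) [S (_ *: v)](linZ lS).
rewrite (linD lS) !(linZ lS) addrA; apply: ncvgD => //.
exact: ncvgZ sc (ncvg_cst _).
Qed.

(** The distance from a + S w to S { q_B = beta } is zero, and it is attained. *)
Lemma closest_points_range beta :
  (exists u, 0 < qform ip B u) -> (exists v, qform ip B v < 0) ->
  selfadjoint ip S ->
  (forall a, exists2 x, qform ip B x = beta &
     forall y, qform ip B y = beta -> rnorm (S x - a) <= rnorm (S y - a)) ->
  forall a, exists x, S x = a.
Proof.
move=> [u qu] [v qv] sS near a.
have [x xa] := dense_range normH lS sS injS a.
have [w [z [N [zN za]]]] := level_set_approx beta qu qv xa.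
have [x0 qx0 hx0] := near (a + S w).
exists (x0 - w); rewrite (linB lS); apply/eqP; rewrite subr_eq -subr_eq0; apply/eqP.
apply: rnorm_eq0; apply/eqP; rewrite eq_le rnorm_ge0 andbT.
rewrite -(cvg_lim _ za)//.
apply: limr_ge; first exact: cvgP za.
by exists N => // n /= Nn; apply/hx0/zN.
Qed.

End RelativelyBounded.
End ClosestPoints.

(** * Extremal values on level sets, and Lagrangians *)

Section Endpoints.
Context (R : realType) (H : completeNormedModType R[i]).
Context (ip : {dot H for Num.conj}).
Implicit Types (x y z u v : H) (r t : R) (A B : H -> H).

Lemma lambda_minus_min A B x : linear A -> linear B -> qform ip B x = 1 ->
  (forall y, qform ip B y = 1 -> qform ip A x <= qform ip A y) ->
  lambda_minus ip A B = - qform ip A x.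
Proof.
move=> lA lB Bx minx; rewrite /lambda_minus; congr (- _).
have lb y : 0 < qform ip B y -> qform ip A x <= qform ip A y / qform ip B y.
  move=> By; have := minx ((Num.sqrt (qform ip B y))^-1%:C *: y).
  rewrite (qformZ _ lA) (qformZ _ lB) exprVn sqr_sqrtr ?(ltW By)//.
  by rewrite mulVf ?gt_eqF// => /(_ erefl); rewrite mulrC.
apply/eqP; rewrite eq_le; apply/andP; split.
  apply: ge_inf; first by exists (qform ip A x) => _ [y By <-]; exact: lb.
  by exists x; rewrite /= Bx ?ltr01 ?divr1.
apply: lb_le_inf; first by exists (qform ip A x / qform ip B x), x; rewrite //= Bx ltr01.
by move=> _ [y By <-]; exact: lb.
Qed.

Lemma lambda_plus_max A B x : linear A -> linear B -> qform ip B x = -1 ->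
  (forall y, qform ip B y = -1 -> qform ip A x <= qform ip A y) ->
  lambda_plus ip A B = qform ip A x.
Proof.
move=> lA lB Bx minx; rewrite /lambda_plus -[RHS]opprK; congr (- _).
have ub y : qform ip B y < 0 -> qform ip A y / qform ip B y <= - qform ip A x.
  move=> By; have By' : 0 < - qform ip B y by rewrite oppr_gt0.
  have := minx ((Num.sqrt (- qform ip B y))^-1%:C *: y).
  rewrite (qformZ _ lA) (qformZ _ lB) exprVn sqr_sqrtr ?(ltW By')//.
  by rewrite invrN !mulNr mulVf ?lt_eqF// => /(_ erefl); rewrite lerNr mulrC.
have Bx0 : qform ip B x < 0 by rewrite Bx ltrN10.
have Ax : qform ip A x / qform ip B x = - qform ip A x by rewrite Bx invrN1 mulrN1.
apply/eqP; rewrite eq_le; apply/andP; split.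
  apply: ge_sup; first by exists (qform ip A x / qform ip B x), x.
  by move=> _ [y By <-]; exact: ub.
apply: ub_le_sup; first by exists (- qform ip A x) => _ [y By <-]; exact: ub.
by exists x.
Qed.

Lemma qform_surjective B u v : linear B -> 0 < qform ip B u -> qform ip B v < 0 ->
  forall r, exists x, qform ip B x = r.
Proof.
move=> lB u0 v0 r; have [r0|r0] := leP 0 r.
  exists ((Num.sqrt (r / qform ip B u))%:C *: u).
  rewrite qformZ// sqr_sqrtr ?divfK ?gt_eqF//.
  by apply: divr_ge0 => //; exact: ltW.
exists ((Num.sqrt (r / qform ip B v))%:C *: v).
rewrite qformZ// sqr_sqrtr ?divfK ?lt_eqF//.
by apply: mulr_le0; rewrite ?invr_le0 ltW.
Qed.

Lemma indefinite_qform B : selfadjoint ip B -> indefinite ip B ->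
  (exists u, 0 < qform ip B u) /\ (exists v, qform ip B v < 0).
Proof.
move=> sB [npB nnB]; split; apply: contrapT => h.
  apply: nnB => x; rewrite lecE /= eq_sym; apply/andP; split.
    by have := Im_ip_conj ip (B x) x; rewrite -sB => e; apply/eqP; lra.
  by rewrite leNgt; apply/negP => ?; apply: h; exists x.
apply: npB; apply: psd_of_qform => // x.
by rewrite leNgt; apply/negP => ?; apply: h; exists x.
Qed.

(** For a linear term of the form T w, completing the square gives
    q_T(y) + 2 Re <T w, y> = q_T(y + w) - q_T(w). *)
Lemma minimizers_shift A B beta w x : linear A -> selfadjoint ip A ->
  linear B -> selfadjoint ip B -> minimizers ip A B beta (A w) (B w) x ->
  qform ip B (x + w) = beta + qform ip B w /\
  forall y, qform ip B y = beta + qform ip B w -> qform ip A (x + w) <= qform ip A y.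
Proof.
move=> lA sA lB sB [].
have shift T y : linear T -> selfadjoint ip T ->
    quadratic_fun ip T (T w) y = qform ip T (y + w) - qform ip T w.
  move=> lT sT; rewrite qformD// /quadratic_fun -/(rdot _ _ _) rdot_sa// (rdotC ip w).
  by ring.
rewrite !shift// => gx minx; split; first by rewrite -gx subrK.
move=> y gy; have := minx (y - w).
by rewrite !shift// subrK gy addrK lerD2r => /(_ erefl).
Qed.

End Endpoints.

Section Lagrangian.
Context (R : realType) (H : completeNormedModType R[i]).
Context (ip : {dot H for Num.conj}).
Context (normH : norm_of_inner_product ip).
Implicit Types (x y z u v : H) (r t : R).
Context (A B : H -> H) (MA MB : R).
Context (bA : bounded_selfadjoint ip A MA) (bB : bounded_selfadjoint ip B MB).
Context (a b : H) (beta : R).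

Definition lagrangian r x : R :=
  quadratic_fun ip A a x + r * (quadratic_fun ip B b x - beta).

Lemma lagrangianE r x : lagrangian r x =
  qform ip (pencil A B r) x + 2 * rdot ip (a + r%:C *: b) x - r * beta.
Proof.
by rewrite /lagrangian /quadratic_fun -!/(rdot _ _ _) qform_pencil !rdotE; ring.
Qed.

Let bP r := pencil_bounded_selfadjoint r bA bB.

Lemma lagrangian_midpoint r x y : positive_semidefinite ip (pencil A B r) ->
  lagrangian r (midpoint x y) <= (lagrangian r x + lagrangian r y) / 2.
Proof.
move=> pP; have [lP sP _ _] := bP r.
have := qform_ge0 (x + (-1)%:C *: y) pP.
rewrite !lagrangianE /midpoint !qformZ// !qformD// qformZ// !rdotE => *.
by lra.
Qed.

Lemma lagrangian_cvg r (u : nat -> H) p : ncvg u p ->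
  (fun n => lagrangian r (u n)) @ \oo --> lagrangian r p.
Proof.
move=> up; have [lP sP _ leP] := bP r.
under eq_fun do rewrite lagrangianE; rewrite lagrangianE.
apply: cvgB; last exact: cvg_cst.
apply: cvgD; first exact: ncvg_rdot (linear_ncvg lP leP up) up.
by apply: cvgM; [exact: cvg_cst|exact: ncvg_rdot (ncvg_cst _) up].
Qed.

(** On the line through [x] directed by a null vector [v] of A + r B, the Lagrangian
    is affine, and the constraint is a quadratic with leading coefficient q_B(v).
    Up to replacing [v] by [- v], the Lagrangian does not increase in the direction
    of [v], and the constraint is met at some nonnegative parameter. *)
Lemma lagrangian_slide r x v : pencil A B r v = 0 -> qform ip B v != 0 ->
  (quadratic_fun ip B b x - beta) * qform ip B v <= 0 ->
  exists2 y, quadratic_fun ip B b y = beta & lagrangian r y <= lagrangian r x.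
Proof.
have [lP sP _ _] := bP r; have [lB sB _ _] := bB.
move: v; suff slide v : pencil A B r v = 0 -> qform ip B v != 0 ->
    (quadratic_fun ip B b x - beta) * qform ip B v <= 0 ->
    rdot ip (a + r%:C *: b) v <= 0 ->
  exists2 y, quadratic_fun ip B b y = beta & lagrangian r y <= lagrangian r x.
  move=> v Pv Bv xv; have [|h] := leP (rdot ip (a + r%:C *: b) v) 0; first exact: slide.
  have Nv : qform ip B (- v) = qform ip B v by rewrite scaleN1 qformZ// sqrrN expr1n mul1r.
  apply: (slide (- v)); rewrite ?Nv//; first by rewrite (linN lP) Pv oppr0.
  by rewrite rdotNr oppr_le0 ltW.
move=> Pv Bv xv h.
have [t t0 e] := quadratic_root (rdot ip (B x) v + rdot ip b v) Bv xv.
exists (x + t%:C *: v).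
  rewrite -e /quadratic_fun -!/(rdot _ _ _) qformD// qformZ// !rdotE; ring.
rewrite !lagrangianE qformD// qformZ// rdotDr !rdotZr.
rewrite (rdot_sa _ _ sP) Pv {2}/qform Pv.
have -> : ip 0 v = 0 by rewrite linear0l.
have -> : rdot ip x 0 = 0 by rewrite -(scale0r (0 : H)) (rdotZr ip 0) mul0r.
have : t * rdot ip (a + r%:C *: b) v <= 0 by rewrite mulr_ge0_le0.
by rewrite /= => *; lra.
Qed.

Context (lm lp l k : R) (u v : H).
Context (lml : lm < l) (llp : l < lp) (k0 : 0 < k).
Context (coer : forall x, k * rnorm x ^+ 2 <= qform ip (pencil A B l) x).
Context (pm : positive_semidefinite ip (pencil A B lm)).
Context (pp : positive_semidefinite ip (pencil A B lp)).
Context (um : pencil A B lm u = 0) (vp : pencil A B lp v = 0).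
Context (Bu : 0 < qform ip B u) (Bv : qform ip B v < 0).

(** A minimiser of the larger of the two endpoint Lagrangians slides to a feasible
    point, along the kernel selected by the sign of g - beta. *)
Lemma minimizers_exist : minimizers ip A B beta a b !=set0.
Proof.
pose F x := Num.max (lagrangian lm x) (lagrangian lp x).
have Fl x : lagrangian l x <= F x.
  have hm : lagrangian lm x <= F x by rewrite le_max lexx.
  have hp : lagrangian lp x <= F x by rewrite le_max lexx orbT.
  have d0 : 0 < lp - lm by rewrite subr_gt0 (lt_trans lml).
  rewrite -(ler_pM2l d0); move: hm hp; rewrite /lagrangian; move: (F x) => f.
  move: (quadratic_fun _ A _ _) (quadratic_fun _ B _ _ - _) => fA fB hm hp.
  have := ler_wpM2l (_ : 0 <= lp - l) hm; rewrite subr_ge0 ltW// => /(_ isT).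
  have := ler_wpM2l (_ : 0 <= l - lm) hp; rewrite subr_ge0 ltW// => /(_ isT).
  by lra.
(* coercivity comes from the inner parameter l, where the Lagrangian is below F *)
have [|||x0 minF] := convex_coercive_min normH (F := F) (k := k)
  (b := 2 * rnorm (a + l%:C *: b)) (d := l * beta) _ _ k0.
- move=> x y r; rewrite /F !ge_max => /andP[h1 h2] /andP[h3 h4].
  have := lagrangian_midpoint x y pm; have := lagrangian_midpoint x y pp.
  by move=> *; apply/andP; split; lra.
- move=> w p wp; rewrite /F maxr_absE; under eq_fun do rewrite maxr_absE.
  have hm := lagrangian_cvg (r := lm) wp; have hp := lagrangian_cvg (r := lp) wp.
  apply: cvgM; last exact: cvg_cst.
  by apply: cvgD; [exact: cvgD|apply: cvg_norm; exact: cvgB].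
- move=> x; apply: le_trans (Fl x); rewrite lagrangianE.
  have := coer x; have := ler_norm (- rdot ip (a + l%:C *: b) x); rewrite normrN.
  have := rdot_le normH (a + l%:C *: b) x.
  by move=> *; lra.
have feas r y : quadratic_fun ip B b y = beta -> lagrangian r y = quadratic_fun ip A a y.
  by move=> gy; rewrite /lagrangian gy subrr mulr0 addr0.
suff [r [y gy Ly]] : exists r, exists2 y, quadratic_fun ip B b y = beta
    & lagrangian r y <= F x0.
  exists y; split=> // z gz; rewrite -(feas r y gy); apply: le_trans Ly _.
  by apply: le_trans (minF z) _; rewrite /F !feas// maxxx.
have [g0|g0] := leP beta (quadratic_fun ip B b x0).
- have [||y gy Ly] := @lagrangian_slide lp x0 v vp; first by rewrite lt_eqF.
    by rewrite nmulr_lle0// subr_ge0.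
  by exists lp, y => //; apply: le_trans Ly _; rewrite le_max lexx orbT.
have [||y gy Ly] := @lagrangian_slide lm x0 u um; first by rewrite gt_eqF.
  by rewrite pmulr_lle0// subr_le0 ltW.
by exists lm, y => //; apply: le_trans Ly _; rewrite le_max lexx.
Qed.

End Lagrangian.

(** * Kernels at the endpoints, and the characterisation of solvability *)

Section Pencil.
Context (R : realType) (H : completeNormedModType R[i]).
Context (ip : {dot H for Num.conj}).
Context (normH : norm_of_inner_product ip).
Context (A B : H -> H) (MA MB : R).
Context (bA : bounded_selfadjoint ip A MA) (bB : bounded_selfadjoint ip B MB).

Let bP r := pencil_bounded_selfadjoint r bA bB.

Lemma pencil_kernels_disjoint r s x : kernel A `&` kernel B = [set 0] -> r != s ->
  pencil A B r x = 0 -> pencil A B s x = 0 -> x = 0.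
Proof.
move=> kerAB rs; rewrite /pencil => Pr Ps.
have Bx : B x = 0.
  have : (r - s)%:C *: B x = 0.
    have := congr2 (fun p q => p - q) Pr Ps.
    by rewrite opprD addrACA !subrr add0r -scalerBl -rmorphB.
  move/eqP; rewrite scaler_eq0 => /orP[|/eqP//].
  by rewrite -(rmorph0 (real_complex R)) => /eqP/complexI/eqP; rewrite subr_eq0 (negPf rs).
move: Pr; rewrite Bx scaler0 addr0 => Ax.
by have : (kernel A `&` kernel B) x by []; rewrite kerAB.
Qed.

(** On the kernel at [r], the form at [s] equals (s - r) q_B, and it can only
    vanish on the common kernel. *)
Lemma qform_kernel_lt0 r s v : kernel A `&` kernel B = [set 0] ->
  positive_semidefinite ip (pencil A B s) -> r != s ->
  pencil A B r v = 0 -> v != 0 -> (r - s) * qform ip B v < 0.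
Proof.
move=> kerAB ps rs Pr v0.
have Pr0 : qform ip (pencil A B r) v = 0 by rewrite /qform Pr linear0l.
have sv : 0 <= qform ip (pencil A B s) v by exact: qform_ge0.
have -> : (r - s) * qform ip B v = - qform ip (pencil A B s) v.
  by move: Pr0; rewrite !qform_pencil => e; lra.
rewrite oppr_lt0 lt_def sv andbT; apply: contra_neq v0 => s0.
exact: pencil_kernels_disjoint kerAB rs Pr (psd_kernel normH (bP s) ps s0).
Qed.

End Pencil.

Theorem theorem4p11 (R : realType) (H : completeNormedModType R[i])
    (ip : {dot H for Num.conj}) (A B : H -> H) (beta : R) :
  norm_of_inner_product ip -> separable H ->
  bounded_operator A -> bounded_operator B ->
  selfadjoint ip A -> selfadjoint ip B ->
  indefinite ip A -> indefinite ip B ->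
  kernel A `&` kernel B = [set 0] ->
  let lm := lambda_minus ip A B in
  let lp := lambda_plus ip A B in
  Igeq ip A B = `[lm, lp]%classic -> lm < lp ->
  let rho := (lm + lp) / 2 in
  (forall a b, range (sqrt_operator ip (pencil A B rho)) a -> range B b ->
     minimizers ip A B beta a b !=set0) <->
  [/\ Igeq ip A B = `[lm, lp]%classic /\ lm < lp,
      kernel (pencil A B lm) <> [set 0] /\ kernel (pencil A B lp) <> [set 0]
    & exists2 lambda, lambda \in `]lm, lp[ &
        range (pencil A B lambda) = [set: H] ].
Proof.
move=> normH _ bdA bdB sA sB _ indB kerAB lm lp eqI lmp rho.
have [MA bA] := bounded_selfadjointI bdA sA.
have [MB bB] := bounded_selfadjointI bdB sB.
have bP r := pencil_bounded_selfadjoint r bA bB.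
have [lA _ _ _] := bA; have [lB _ _ _] := bB.
have psdP r : lm <= r <= lp -> positive_semidefinite ip (pencil A B r).
  by move=> h; have : Igeq ip A B r by rewrite eqI /= in_itv.
have pm : positive_semidefinite ip (pencil A B lm) by apply: psdP; rewrite lexx ltW.
have pp : positive_semidefinite ip (pencil A B lp) by apply: psdP; rewrite lexx ltW.
have [[u0 Bu0] [v0 Bv0]] := indefinite_qform sB indB.
have ker0 r : kernel (pencil A B r) <> [set 0] <->
    exists2 v, v != 0 & pencil A B r v = 0.
  have [lP _ _ _] := bP r; split=> [ne|[v vn Pv] e].
    apply: contrapT => nv; apply: ne; apply/seteqP; split=> [v Pv|_ ->]; last exact: lin0.
    by apply/eqP; apply: contrapT => /negP vn; apply: nv; exists v.
  have : kernel (pencil A B r) v by [].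
  by rewrite e => v0'; rewrite v0' eqxx in vn.
split=> [minZ|[_ [/ker0[u un Pu] /ker0[v vn Pv]] [l]]]; last first.
  rewrite in_itv /= => /andP[lml llp] surl a b _ _.
  have pl : positive_semidefinite ip (pencil A B l) by apply: psdP; rewrite !ltW.
  have [y|k k0 coer] := surjective_coercive normH (bP l) pl.
    have [x _ <-] : range (pencil A B l) y by rewrite surl.
    by exists x.
  apply: (minimizers_exist normH bA bB a b beta lml llp k0 coer pm pp Pu Pv).
    have := qform_kernel_lt0 normH bA bB kerAB pp (negbT (lt_eqF lmp)) Pu un.
    by rewrite nmulr_rlt0 // subr_lt0.
  have := qform_kernel_lt0 normH bA bB kerAB pm (negbT (gt_eqF lmp)) Pv vn.
  by rewrite pmulr_rlt0 // subr_gt0.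
have prho : positive_semidefinite ip (pencil A B rho) by apply: psdP; rewrite /rho; lra.
have [bS pS SS] : [/\ bounded_operator (sqrt_operator ip (pencil A B rho)),
    positive_semidefinite ip (sqrt_operator ip (pencil A B rho)) &
    forall x, sqrt_operator ip (pencil A B rho) (sqrt_operator ip (pencil A B rho) x)
      = pencil A B rho x].
  have [S hS] := psd_sqrt normH (bP rho) prho.
  exact: (@xgetPex _ (fun=> 0) [set S | [/\ bounded_operator S, positive_semidefinite ip S
                            & forall x, S (S x) = pencil A B rho x]] (ex_intro _ S hS)).
set S := sqrt_operator ip (pencil A B rho) in minZ bS pS SS.
have lS : linear S by case: bS.
have sS : selfadjoint ip S by exact: psd_selfadjoint.
have qS x : rnorm (S x) ^+ 2 = qform ip A x + rho * qform ip B x.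
  by rewrite -(rdotxx normH) -(rdot_sa (S x) x sS) SS -qform_pencil.
have injS x : S x = 0 -> x = 0.
  move=> Sx; have := qS x; rewrite Sx rnorm0 expr0n /= => q0.
  have := qform_ge0 x pm; have := qform_ge0 x pp; rewrite !qform_pencil => hp hm.
  apply: (pencil_kernels_disjoint kerAB (negbT (lt_eqF lmp))).
    by apply: (psd_kernel normH (bP lm) pm); rewrite qform_pencil; rewrite /rho in q0; lra.
  by apply: (psd_kernel normH (bP lp) pp); rewrite qform_pencil; rewrite /rho in q0; lra.
have delta0 : 0 < (lp - lm) / 2 by rewrite divr_gt0 // subr_gt0.
have BS x : (lp - lm) / 2 * `|qform ip B x| <= rnorm (S x) ^+ 2.
  have := qform_ge0 x pm; have := qform_ge0 x pp; rewrite !qform_pencil qS /rho => hp hm.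
  by case: (ger0P (qform ip B x)) => _; lra.
(* for b = 0 and the linear term - S a, f is |S x - a|^2 up to a constant on the
   level set *)
have surS a : exists x, S x = a.
  apply: (@closest_points_range _ _ _ normH B S _ lB sB lS injS delta0 BS beta) => //;
    [by exists u0|by exists v0|] => {}a.
  have [|| x [gx minx]] := minZ (S (- a)) 0.
  - by exists (- a).
  - by exists 0 => //; exact: lin0.
  have quad0 y : quadratic_fun ip B 0 y = qform ip B y.
    by rewrite /quadratic_fun linear0l mulr0 addr0.
  exists x => [|y By]; first by rewrite -quad0.
  have dist z : qform ip B z = beta -> rnorm (S z - a) ^+ 2 =
      quadratic_fun ip A (S (- a)) z + rho * beta + rnorm a ^+ 2.
    move=> Bz; rewrite -!(rdotxx normH) /quadratic_fun -/(rdot ip _ _).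
    rewrite (rdot_sa (- a) z sS) !rdotE (rdotC ip _ a).
    by have := qS z; rewrite Bz (rdotxx normH) => ->; ring.
  rewrite -ler_sqr ?nnegrE ?rnorm_ge0// !dist//; last by rewrite -quad0.
  by rewrite !lerD2r; apply: minx; rewrite quad0.
(* w is chosen so that the shift by w moves the level from beta to r *)
have level r : exists2 x, qform ip B x = r &
    forall y, qform ip B y = r -> qform ip A x <= qform ip A y.
  have [w Bw] := qform_surjective lB Bu0 Bv0 (r - beta).
  have [||x] := minZ (A w) (B w).
  - by have [y Sy] := surS (A w); exists y.
  - by exists w.
  move=> /(minimizers_shift lA sA lB sB); rewrite Bw [beta + _]addrC subrK => -[h1 h2].
  by exists (x + w).
split=> //.
- split; apply/ker0.
    have [x Bx minx] := level 1; exists x.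
      apply: contra_eq_neq Bx => ->; rewrite /qform lin0// linear0l.
      by rewrite eq_sym oner_eq0.
    apply: (psd_kernel normH (bP lm) pm).
    by rewrite qform_pencil Bx /lm (lambda_minus_min lA lB Bx minx); ring.
  have [x Bx minx] := level (-1); exists x.
    apply: contra_eq_neq Bx => ->; rewrite /qform lin0// linear0l.
    by rewrite eq_sym oppr_eq0 oner_eq0.
  apply: (psd_kernel normH (bP lp) pp).
  by rewrite qform_pencil Bx /lp (lambda_plus_max lA lB Bx minx); ring.
exists rho; first by rewrite in_itv /= /rho; apply/andP; split; lra.
apply/seteqP; split=> // y _.
have [z Sz] := surS y; have [x Sx] := surS z.
by exists x => //; rewrite -SS Sx.
Qed.
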